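(* Given a stochastic multi-armed bandit game with $K$ arms, under attack with budget $C$, and $T>KC$ decision rounds, for any bandit algorithm there exists an attack policy with budget $C$ that can make the algorithm suffer $\Omega(KC)$ regret.
   Context: Stochastic multi-armed bandit with adversarial attacks. There are $K\in\mathbb N^+$ arms $\mathcal K=\{1,\dots,K\}$; arm $k$ is associated with a reward random variable $X_k\in[0,1]$ with unknown mean $\mu_k$. The arm of highest mean, $k^*$, is unique. In each round $t\in\mathcal T=\{1,\dots,T\}$: the learner (the bandit algorithm) pulls an arm $I_t$; a stochastic reward $X_{I_t,t}$ is drawn from this arm; the adversary observes $I_t$ and $X_{I_t,t}$ and then chooses an attacked reward $\tilde X_{I_t,t}$; the learner observes only $\tilde X_{I_t,t}$, not $X_{I_t,t}$. The total attack is $\sum_{t=1}^T|X_{I_t,t}-\tilde X_{I_t,t}|$; an attack policy has budget $C$ if its total attack is at most $C$. The (realized) regret is defined on the raw rewards as $R_T=\max_{k\in\mathcal K}\sum_{t\in\mathcal T}(X_{k,t}-X_{I_t,t})$; the pseudo-regret is $\bar R_T=\max_{k\in\mathcal K}\mathbb E\big[\sum_{t\in\mathcal T}(X_{k,t}-X_{I_t,t})\big]=\mathbb E\big[T\mu_{k^*}-\sum_{t\in\mathcal T}\mu_{I_t}\big]\le\mathbb E[R_T]$.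
   Formalization: Read as a minimax bound: the game's reward distributions are chosen, with the attack policy, after the algorithm (for a fixed game, always pulling the best arm has zero pseudo-regret), and K is at least 2 (for K = 1 regret is 0). *)

(* Defs.v *)
From HB Require Import structures.
From mathcomp Require Import all_boot all_order all_algebra.
From mathcomp Require Import all_classical all_reals all_analysis.

Set Implicit Arguments.
Unset Strict Implicit.
Unset Printing Implicit Defensive.

Import Order.TTheory GRing.Theory Num.Theory.
Import numFieldNormedType.Exports.

Local Open Scope classical_set_scope.
Local Open Scope ring_scope.

(* The arms are the elements of 'I_K, and rounds are
   numbered from 0, so that the T rounds of a game are t = 0, ..., T - 1. *)

(* A possibly randomized learner.  Its internal randomness is a seed drawn from
   an arbitrary probability space; given the seed, the next arm is a measurable
   function of the past pairs (pulled arm, observed reward), listed in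
   chronological order. *)
Record bandit_algorithm (R : realType) (K : nat) := BanditAlgorithm {
  seed_display : measure_display ;
  seed_space : measurableType seed_display ;
  seed_law : probability seed_space R ;
  decide : seed_space -> seq ('I_K * R) -> 'I_K ;
  measurable_decide : forall (t : nat) (a : t.-tuple 'I_K) (k : 'I_K),
    measurable [set p : seed_space * t.-tuple R | decide p.1 (zip a p.2) = k]
}.

(* [attack h i x] is the attacked reward sent to the learner when the past pairs
   (pulled arm, raw reward) are [h], the learner pulls [i] and the raw reward is
   [x].  The past attacked rewards are functions of [h]. *)
Record attack_policy (R : realType) (K : nat) := AttackPolicy {
  attack : seq ('I_K * R) -> 'I_K -> R -> R ;
  measurable_attack : forall (t : nat) (a : t.-tuple 'I_K) (i : 'I_K),
    measurable_fun [set: t.-tuple R * R]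
      (fun p : t.-tuple R * R => attack (zip a p.1) i p.2)
}.

(* The budget is enforced surely: for every sequence of pulled arms and every
   sequence of raw rewards. *)
Definition has_budget (R : realType) (K T : nat) (C : R)
    (adv : attack_policy R K) : Prop :=
  forall (a : nat -> 'I_K) (x : nat -> R), (forall t, 0 <= x t <= 1) ->
  \sum_(t < T)
    `|x t - attack adv [seq (a s, x s) | s <- iota 0 t] (a t) (x t)| <= C.

Record bandit_instance (R : realType) (K : nat) := BanditInstance {
  reward_law : 'I_K -> probability R R ;
  reward_law01 : forall k, reward_law k `[0, 1]%classic = 1%E ;
  unique_best_arm : exists k : 'I_K, forall j : 'I_K, j != k ->
    (\int[reward_law j]_x x%:E < \int[reward_law k]_x x%:E)%E
}.

(* Random variables driving T rounds of a game: the learner's seed and the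
   rewards X_{k,t}, all mutually independent.  [reward k t] is unconstrained
   (and irrelevant) for T <= t.  In [realization_indep], taking some of the
   sets to be full gives the product rule for all subfamilies. *)
Record realization (R : realType) (K T : nat) (alg : bandit_algorithm R K)
    (inst : bandit_instance R K) := Realization {
  sample_display : measure_display ;
  sample_space : measurableType sample_display ;
  sample_prob : probability sample_space R ;
  seed : {RV sample_prob >-> seed_space alg} ;
  reward : 'I_K -> nat -> {RV sample_prob >-> R} ;
  seed_distribution : forall A : set (seed_space alg), measurable A ->
    distribution sample_prob seed A = seed_law alg A ;
  reward_distribution : forall (k : 'I_K) (t : 'I_T) (B : set R),
    measurable B ->
    distribution sample_prob (reward k t) B = reward_law inst k B ;
  realization_indep :
    forall (A : set (seed_space alg)) (B : 'I_K -> 'I_T -> set R),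
    measurable A -> (forall k t, measurable (B k t)) ->
    sample_prob (seed @^-1` A `&`
      [set w | forall (k : 'I_K) (t : 'I_T), B k t (reward k t w)]) =
    (sample_prob (seed @^-1` A) *
     \prod_(k < K) \prod_(t < T) sample_prob (reward k t @^-1` B k t))%E
}.

Lemma exists_product_tuple (R : realType) (n : nat)
    (mu : 'I_n -> probability R R) :
  exists Q : probability (n.-tuple R) R,
  forall B : 'I_n -> set R, (forall i, measurable (B i)) ->
    Q [set x | forall i, B i (tnth x i)] = (\prod_(i < n) mu i (B i))%E.
Proof.
elim: n mu => [|n IH] mu.
  exists [the probability _ _ of \d_([tuple] : 0.-tuple R)] => B mB.
  rewrite big_ord0 /= diracE mem_set//=.
  by case.
have [Q QE] := IH (fun i => mu (lift ord0 i)).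
pose f (p : R * n.-tuple R) : n.+1.-tuple R := [the n.+1.-tuple R of p.1 :: p.2].
have mf : measurable_fun [set: R * n.-tuple R] f.
  by apply: measurable_cons; [exact: measurable_fst|exact: measurable_snd].
pose F := HB.pack_for {mfun (R * n.-tuple R)%type >-> (n.+1).-tuple R} f
  (isMeasurableFun.Build _ _ _ _ f mf).
exists [the probability _ _ of distribution [the probability _ _ of (mu ord0 \x Q)%E] F] => B mB.
rewrite big_ord_recl -QE//= /distribution /pushforward /=.
rewrite -product_measure1E//; last first.
  rewrite (_ : [set _ | _] =
    \bigcap_(i in [set: 'I_n]) ((@tnth n R)^~ i @^-1` B (lift ord0 i))).
    apply: fin_bigcap_measurable => // i _; rewrite -[X in measurable X]setTI.
    exact: measurable_tnth.
  by apply/seteqP; split=> [x h i _|x h i]; [exact: h|exact: (h i Logic.I)].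
congr (product_measure1 _ _ _); apply/seteqP; split=> -[x y] /=.
  move=> h; split; first exact: (h ord0).
  by move=> i; have := h (lift ord0 i); rewrite tnthS.
move=> [h1 h2] i; have [j ->|->] := unliftP ord0 i; last exact: h1.
by rewrite tnthS; exact: h2.
Qed.

(* Every game has a realization, hence quantifying over all of them is never
   vacuous. *)
Lemma realization_exists (R : realType) (K T : nat) (alg : bandit_algorithm R K)
  (inst : bandit_instance R K) : inhabited (realization T alg inst).
Proof.
pose I := ('I_K * 'I_T)%type.
have [Q QE] := exists_product_tuple (fun e : 'I_#|{: I}| => reward_law inst (enum_val e).1).
pose Om := (seed_space alg * #|{: I}|.-tuple R)%type.
pose P := [the probability _ _ of (seed_law alg \x Q)%E].
pose U := HB.pack_for {mfun Om >-> seed_space alg} (@fst _ _)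
  (isMeasurableFun.Build _ _ _ _ _ (@measurable_fst _ _ (seed_space alg) (#|{: I}|.-tuple R))).
pose x (k : 'I_K) (t : nat) (w : Om) : R :=
  if insub t is Some t' then tnth w.2 (enum_rank ((k, t') : I)) else 0.
have mx k t : measurable_fun [set: Om] (x k t).
  rewrite /x; case: insubP => [t' _ _|_] //=.
  apply: (@measurableT_comp _ _ _ _ _ _ (fun y => tnth y (enum_rank ((k, t') : I)))) => //.
  exact: measurable_tnth.
pose X k t := HB.pack_for {mfun Om >-> R} (x k t)
  (isMeasurableFun.Build _ _ _ _ _ (mx k t)).
have xE k (t : 'I_T) w : x k t w = tnth w.2 (enum_rank ((k, t) : I)).
  by rewrite /x valK.
have mm (B : 'I_#|{: I}| -> set R) : (forall i, measurable (B i)) ->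
    measurable [set y : #|{: I}|.-tuple R | forall i, B i (tnth y i)].
  move=> mB; rewrite (_ : [set _ | _] =
    \bigcap_(i in [set: 'I_#|{: I}|]) ((@tnth _ R)^~ i @^-1` B i)).
    apply: fin_bigcap_measurable => // i _; rewrite -[X in measurable X]setTI.
    exact: measurable_tnth.
  by apply/seteqP; split=> [y h i _|y h i]; [exact: h|exact: (h i Logic.I)].
have box (A : set (seed_space alg)) (B : 'I_K -> 'I_T -> set R) :
    measurable A -> (forall k t, measurable (B k t)) ->
    P (U @^-1` A `&` [set w | forall (k : 'I_K) (t : 'I_T), B k t (X k t w)]) =
    (seed_law alg A * \prod_(k < K) \prod_(t < T) reward_law inst k (B k t))%E.
  move=> mA mB.
  rewrite pair_big/= (reindex (fun e : 'I_#|{: I}| => enum_val e))/=; last first.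
    exact/onW_bij/enum_val_bij.
  rewrite -(QE (fun e => B (enum_val e).1 (enum_val e).2))//.
  rewrite -product_measure1E//; last by apply: (mm (fun e => B (enum_val e).1 (enum_val e).2)).
  congr (product_measure1 _ _ _); apply/seteqP; split=> -[s y] /= [h1 h2].
    split=> // e; have := h2 (enum_val e).1 (enum_val e).2.
    by rewrite xE -surjective_pairing enum_valK.
  split=> // k t; have := h2 (enum_rank ((k, t) : I)).
  by rewrite xE enum_rankK.
have lawU A : measurable A -> P (U @^-1` A) = seed_law alg A.
  move=> mA; have := box A (fun _ _ => setT) mA (fun _ _ => measurableT).
  rewrite (_ : [set w | _] = setT) ?setIT; last by apply/seteqP; split.
  move=> ->; rewrite big1 ?mule1// => k _; rewrite big1// => t _.
  exact: probability_setT.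
have lawX k (t : 'I_T) B : measurable B -> P (X k t @^-1` B) = reward_law inst k B.
  move=> mB.
  have mB' k' t' : measurable (if ((k', t') == (k, t) :> I) then B else setT).
    by case: ifP.
  have := box setT (fun k' t' => if ((k', t') == (k, t) :> I) then B else setT)
     measurableT mB'.
  rewrite preimage_setT setTI probability_setT mul1e.
  rewrite pair_big/= (bigD1 ((k, t) : I))//= eqxx big1 ?mule1; last first.
    move=> [k' t'] /= /negbTE ->; exact: probability_setT.
  move=> <-; congr (P _); apply/seteqP; split=> w /=.
    by move=> h k' t'; case: eqP => // -[-> ->].
  by move/(_ k t); rewrite eqxx.
constructor; apply: (@Realization _ _ _ _ _ _ _ P U X) => //.
- move=> A B mA mB; rewrite box// lawU//; congr *%E.
  by apply: eq_bigr => k _; apply: eq_bigr => t _; rewrite lawX.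
Qed.

Section game.
Context (R : realType) (K T : nat) (alg : bandit_algorithm R K)
  (adv : attack_policy R K) (inst : bandit_instance R K)
  (G : realization T alg inst).

(* The pair (raw history, observed history) after [t] rounds: the adversary sees
   the former, the learner only the latter. *)
Fixpoint histories (t : nat) (w : sample_space G) :
    seq ('I_K * R) * seq ('I_K * R) :=
  if t is t'.+1 then
    let raw := (histories t' w).1 in
    let obs := (histories t' w).2 in
    let i := decide (seed G w) obs in
    let x := reward G i t' w in
    (rcons raw (i, x), rcons obs (i, attack adv raw i x))
  else ([::], [::]).

Definition pulled_arm (t : nat) (w : sample_space G) : 'I_K :=
  decide (seed G w) (histories t w).2.

Definition regret_against (k : 'I_K) (w : sample_space G) : R :=
  \sum_(t < T) (reward G k t w - reward G (pulled_arm t w) t w).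

(* Maxima over the arms are taken in the extended reals, where -oo is neutral;
   they are attained at some arm as soon as there is one. *)
Definition realized_regret (w : sample_space G) : \bar R :=
  \big[maxe/-oo%E]_(k < K) (regret_against k w)%:E.

Definition expected_regret : \bar R :=
  (\int[sample_prob G]_w realized_regret w)%E.

Definition pseudo_regret : \bar R :=
  \big[maxe/-oo%E]_(k < K) ('E_(sample_prob G)[regret_against k])%E.

End game.

(* Main.v *)
(* Let m be the integer part of C, and run the learner in the world where every
   observed reward is 0.  Over n of order K(m+1) rounds, averaging over the arms
   yields an arm j whose pulls are at most m and leave many rounds for the other
   arms, in expectation.  Give arm j the constant reward 1 and all other arms
   the constant reward 0, and let the adversary zero the first m pulls of j:
   until j is pulled m+1 times the learner cannot leave the all-zero world, so
   each of its pulls of another arm costs 1. *)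
Require Import Defs.
From mathcomp Require Import all_boot all_order all_algebra.
From mathcomp Require Import all_classical all_reals all_analysis.
From mathcomp Require Import measurable_realfun.
From mathcomp Require Import lra zify.

Import Order.TTheory GRing.Theory Num.Theory.
Import numFieldNormedType.Exports.
Local Open Scope classical_set_scope.
Local Open Scope ring_scope.

Set Implicit Arguments.
Unset Strict Implicit.
Unset Printing Implicit Defensive.

(** * Lower bounds for integrals of possibly non-measurable functions *)

Section integral_ge_of_ge_on_conull.
Import HBNNSimple.

(* [f] need not be measurable: the integrals of its positive and negative parts
   are suprema over the simple functions below them. *)
Lemma integral_ge_of_ge_on_conull d (X : measurableType d) (R : realType)
    (mu : {measure set X -> \bar R}) (E : set X) (f g : X -> \bar R) :
  measurable E -> mu (~` E) = 0%E -> measurable_fun [set: X] g ->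
  (forall x, 0 <= g x)%E -> (forall x, E x -> g x <= f x)%E ->
  (\int[mu]_x g x <= \int[mu]_x f x)%E.
Proof.
move=> mE muE mg g0 gf.
have setTDE : [set: X] `\` ~` E = E by rewrite setTD setCK.
have conull (h : X -> \bar R) : measurable_fun [set: X] h ->
    (forall x, 0 <= h x)%E -> (\int[mu]_x h x = \int[mu]_(x in E) h x)%E.
  move=> mh h0; rewrite (@ge0_negligible_integral _ _ _ mu _ (~` E))//.
    by rewrite setTDE.
  exact: measurableC.
rewrite [leRHS]integralE.
have -> : (\int[mu]_x (f^\- x) = 0)%E.
  apply/eqP; rewrite eq_le integral_ge0 ?andbT//.
  (* A simple function below [f^\-] vanishes on [E], where [0 <= g <= f], so its integral is 0. *)
  rewrite ge0_integralTE//; apply: ge_ereal_sup => /= _ [h hf <-].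
  rewrite -(patch_setT (cst 0) (h : X -> R)) -integral_nnsfun//.
  rewrite conull; last 2 first.
  - by apply/measurable_EFinP.
  - by move=> x; rewrite lee_fin.
  rewrite integral0_eq// => x Ex.
  apply/eqP; rewrite eq_le [X in _ && X]lee_fin fun_ge0 andbT.
  apply: (le_trans (hf x)); rewrite funenegE ge_max lexx andbT leeNl oppe0.
  exact: le_trans (gf x Ex).
rewrite sube0 conull// ge0_integralE// ge0_integralTE//.
apply: ereal_sup_le => _ /= [h hg <-].
(* Off [E] the patched [g] is 0, so [h] lies below [f^\+] there too. *)
exists h => // x; apply: (le_trans (hg x)); rewrite /patch.
case: ifPn => [|_]; last exact: funepos_ge0.
by rewrite inE => Ex; apply: (le_trans (gf x Ex)); rewrite funeposE le_max lexx.
Qed.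

End integral_ge_of_ge_on_conull.

(** * The learner in the all-zero world *)

Section null_world.
Context (R : realType) (K : nat) (alg : bandit_algorithm R K).

(** The null world depends on the seed alone, not on any instance or realization. *)
Fixpoint null_arms (t : nat) (s : seed_space alg) : seq 'I_K :=
  if t is t'.+1 then
    rcons (null_arms t' s) (decide s [seq (i, 0) | i <- null_arms t' s])
  else [::].

Lemma size_null_arms t s : size (null_arms t s) = t.
Proof. by elim: t => //= t IH; rewrite size_rcons IH. Qed.

(** This is the section of the set in [measurable_decide] at the zero reward tuple. *)
Lemma measurable_decide_null (a : seq 'I_K) k :
  measurable [set s : seed_space alg | decide s [seq (i, 0) | i <- a] = k].
Proof.
have zipE : zip a [tuple (0 : R) | i < size a] = [seq (i, 0) | i <- a].
  have zip_map (l : seq 'I_(size a)) (b : seq 'I_K) : size l = size b ->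
      zip b [seq 0 : R | _ <- l] = [seq (i, 0) | i <- b].
    by elim: b l => [|i b IH] [|e l]//= [/IH ->].
  by rewrite /= zip_map// size_enum_ord.
have := measurable_ysection [tuple (0 : R) | i < size a]
  (@measurable_decide _ _ alg _ (in_tuple a) k).
congr measurable; apply/seteqP; split=> s; rewrite /ysection/= inE/= -zipE//.
Qed.

Lemma measurable_null_arms t (a : seq 'I_K) :
  measurable [set s | null_arms t s = a].
Proof.
elim: t a => [|t IH] a /=.
  case: (pselect ([::] = a)) => h.
    by rewrite (_ : [set _ | _] = setT)//; apply/seteqP; split.
  by rewrite (_ : [set _ | _] = set0)//; apply/seteqP; split.
case/lastP: a => [|a k].
  rewrite (_ : [set _ | _] = set0)//; apply/seteqP; split => // s /=.
  by move/(congr1 size); rewrite size_rcons.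
rewrite (_ : [set _ | _] = [set s | null_arms t s = a] `&`
   [set s | decide s [seq (i, 0) | i <- a] = k]).
  by apply: measurableI => //; exact: measurable_decide_null.
apply/seteqP; split => s /=; last by move=> [-> ->].
by move/rcons_inj => [-> ->].
Qed.

(** [f] can be arbitrary because [null_arms t] takes finitely many values, each on a measurable
    set. *)
Lemma measurable_fun_null_arms d (Y : measurableType d) t
    (f : seq 'I_K -> Y) :
  measurable_fun [set: seed_space alg] (fun s => f (null_arms t s)).
Proof.
move=> _ B mB; rewrite setTI (_ : _ @^-1` _ =
  \bigcup_(a in [set a : t.-tuple 'I_K | B (f a)])
    [set s | null_arms t s = a]).
  apply: fin_bigcup_measurable => [|a _]; last exact: measurable_null_arms.
  exact: finite_finset.
apply/seteqP; split => [s /= Bs|s [a /= Ba ->]//].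
have sz : size (null_arms t s) == t by rewrite size_null_arms.
by exists (Tuple sz).
Qed.

(* In the game where only arm [k] pays and its first [m] pulls are attacked, the
   null world is a faithful copy of the first [n] rounds only as long as [k] is
   pulled at most [m] times; otherwise the regret is bounded below by 0. *)
Definition missed (n m : nat) (k : 'I_K) (s : seed_space alg) : R :=
  let c := count_mem k (null_arms n s) in
  if (c <= m)%N then (n - c)%:R else 0.

Lemma missed_ge0 n m k s : 0 <= missed n m k s.
Proof. by rewrite /missed; case: ifP. Qed.

Lemma measurable_missed n m k : measurable_fun [set: seed_space alg] (missed n m k).
Proof.
exact: (@measurable_fun_null_arms _ R n (fun a => let c := count_mem k a in
  if (c <= m)%N then (n - c)%:R else 0)).
Qed.

(** The pull counts of the arms add up to [n], so the bounds [low] sum to [n] times [K - n / m.+1],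
    where [n / m.+1 <= K / 2]. *)
Lemma sum_missed n m s : (m < n)%N -> (n.*2 <= K * m.+1)%N ->
  K%:R * n%:R / 2 <= \sum_(k < K) missed n m k s.
Proof.
move=> mn nK.
have sumc : (\sum_(k < K) count_mem k (null_arms n s) = n)%N.
  rewrite -[RHS](size_null_arms n s); elim: (null_arms n s) => [|a l IH] /=.
    by rewrite big1.
  rewrite big_split/= IH (bigD1 a)//= eqxx big1 => [|i /negbTE]; first by [].
  by rewrite eq_sym => ->.
(* Markov's inequality, pointwise; it uses [m.+1 <= n]. *)
have low k : n%:R * (1 - (count_mem k (null_arms n s))%:R / m.+1%:R)
    <= missed n m k s.
  rewrite /missed; set c := count_mem _ _.
  have cn : (c <= n)%N by rewrite -[X in (_ <= X)%N](size_null_arms n s) count_size.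
  have m0 : 0 < m.+1%:R :> R by rewrite ltr0n.
  case: ifPn => [cm|]; rewrite ?natrB// -(ler_pM2r m0).
    rewrite -mulrA mulrBl divfK ?gt_eqF// mul1r mulrBr mulrBl lerB// -!natrM ler_nat.
    by rewrite mulnC leq_mul2r mn orbT.
  rewrite -ltnNge => mc; rewrite mul0r -mulrA mulrBl divfK ?gt_eqF// mul1r.
  by rewrite mulr_ge0_le0// subr_le0 ler_nat.
apply: le_trans (ler_sum _ (fun k _ => low k)).
rewrite -mulr_sumr sumrB -mulr_suml -natr_sum sumc sumr_const card_ord.
have nK' : n%:R / m.+1%:R <= K%:R / 2 :> R.
  by rewrite ler_pdivrMr ?ltr0n// mulrAC ler_pdivlMr// -!natrM ler_nat muln2.
rewrite [K%:R * _]mulrC -mulrA ler_wpM2l//; move: nK'; set u := n%:R / _; lra.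
Qed.

(** Averaging: by [sum_missed], the integrals over the [K] arms add up to at least [K * n / 2]. *)
Lemma exists_missed n m : (0 < K)%N -> (m < n)%N -> (n.*2 <= K * m.+1)%N ->
  exists k : 'I_K, ((n%:R / 2)%:E <= \int[seed_law alg]_s (missed n m k s)%:E)%E.
Proof.
move=> K0 mn nK; apply: contrapT => /forallNP noK.
have lt k : (\int[seed_law alg]_s (missed n m k s)%:E < (n%:R / 2)%:E)%E.
  by rewrite ltNge; apply/negP/noK.
have : ((K%:R * n%:R / 2)%:E <= \sum_(k < K) \int[seed_law alg]_s (missed n m k s)%:E)%E.
  rewrite -ge0_integral_sum//=; last 2 first.
  - by move=> k; apply/measurable_EFinP; exact: measurable_missed.
  - by move=> k s _; rewrite lee_fin missed_ge0.
  apply: (@le_trans _ _ (\int[seed_law alg]_s (K%:R * n%:R / 2)%:E)%E).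
    by rewrite integral_cst//= probability_setT mule1.
  apply: ge0_le_integral => //=.
  - apply: emeasurable_sum => k; apply/measurable_EFinP; exact: measurable_missed.
  - by move=> s _; rewrite sumEFin lee_fin; exact: sum_missed.
apply/negP; rewrite -ltNge.
have -> : ((K%:R * n%:R / 2)%:E = \sum_(k < K) (n%:R / 2)%:E :> \bar R)%E.
  by rewrite sumEFin sumr_const card_ord -mulrA mulr_natl.
(* Strict inequalities are summed among reals, so the integrals must be finite; [K0] makes the sum
   nonempty. *)
have fin k : (\int[seed_law alg]_s (missed n m k s)%:E)%E \is a fin_num.
  rewrite ge0_fin_numE; first exact: lt_trans (lt k) (ltry _).
  by apply: integral_ge0 => s _; rewrite lee_fin missed_ge0.
rewrite (eq_bigr (fun k => (fine (\int[seed_law alg]_s (missed n m k s)%:E))%:E)).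
  rewrite !sumEFin lte_fin; apply: ltr_sum => [|k _].
    by apply/hasP; exists (Ordinal K0); rewrite ?mem_index_enum.
  by rewrite -lte_fin fineK.
by move=> k _; rewrite fineK.
Qed.

End null_world.

(** * The attack and the hard instance *)

Section suppression.
Context (R : realType) (K : nat) (j : 'I_K).

Definition suppress (m : nat) (h : seq ('I_K * R)) (i : 'I_K) (x : R) : R :=
  if (i == j) && (count_mem j (map fst h) < m)%N then 0 else x.

Lemma measurable_suppress m (t : nat) (a : t.-tuple 'I_K) (i : 'I_K) :
  measurable_fun [set: t.-tuple R * R]
    (fun p : t.-tuple R * R => suppress m (zip a p.1) i p.2).
Proof.
have -> : (fun p : t.-tuple R * R => suppress m (zip a p.1) i p.2) =
    fun p => if (i == j) && (count_mem j a < m)%N then 0 else p.2.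
  by apply/funext => p; rewrite /suppress -/(unzip1 _) unzip1_zip// !size_tuple.
by case: (_ && _); [exact: measurable_cst|exact: measurable_snd].
Qed.

Definition suppression (m : nat) : attack_policy R K :=
  AttackPolicy (@measurable_suppress m).

Lemma suppression_budget (T m : nat) : has_budget T m%:R (suppression m).
Proof.
(* The induction on [T] needs the sharper bound that also counts the pulls of [j]: each of the first
   [m] costs at most 1, the later ones nothing. *)
move=> a x x01; suff : \sum_(t < T) `|x t - attack (suppression m)
    [seq (a s, x s) | s <- iota 0 t] (a t) (x t)|
    <= (minn m (count_mem j [seq a s | s <- iota 0 T]))%:R.
  by move/le_trans; apply; rewrite ler_nat geq_minl.
elim: T => [|T IH]; first by rewrite big_ord0.
rewrite big_ord_recr -[in leRHS](addn1 T) iotaD map_cat count_cat/= add0n addn0.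
rewrite {2}/suppress -map_comp (_ : fst \o _ = a)//.
set c := count_mem j _ in IH *.
case: (a T == j) => /=; last by rewrite subrr normr0 addr0 addn0.
case: ifPn => cm.
  have -> : minn m (c + 1) = (minn m c + 1)%N by lia.
  have /andP[x0 x1] := x01 T.
  by rewrite natrD lerD// subr0 ger0_norm.
by rewrite subrr normr0 addr0 (le_trans IH)// ler_nat; lia.
Qed.

Definition spike_law (k : 'I_K) : probability R R :=
  [the probability _ _ of \d_((k == j)%:R : R)].

Lemma spike_law01 k : spike_law k `[0, 1]%classic = 1%E.
Proof.
rewrite /spike_law/= diracE mem_set//= in_itv/=.
by case: (k == j); rewrite !lexx ler01.
Qed.

Lemma integral_spike_law k : (\int[spike_law k]_x x%:E = (k == j)%:R%:E)%E.
Proof. by rewrite /spike_law integral_dirac// diracT mul1e. Qed.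

Lemma spike_best : exists k : 'I_K, forall i : 'I_K, i != k ->
  (\int[spike_law i]_x x%:E < \int[spike_law k]_x x%:E)%E.
Proof.
exists j => i /negbTE ij; rewrite !integral_spike_law eqxx ij lte_fin.
exact: ltr01.
Qed.

Definition spike : bandit_instance R K := BanditInstance spike_law01 spike_best.

(** * The regret in a game on the hard instance *)

Context (alg : bandit_algorithm R K) (T : nat) (G : realization T alg spike).

(** A realization prescribes only the laws of the rewards, so these values hold almost surely rather
    than surely. *)
Definition typical : set (sample_space G) :=
  [set w | forall (k : 'I_K) (t : 'I_T), reward G k t w = (k == j)%:R].

Lemma measurable_typical : measurable typical.
Proof.
rewrite (_ : typical = \bigcap_(p in [set: 'I_K * 'I_T])
    (reward G p.1 p.2 @^-1` [set (p.1 == j)%:R])).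
  apply: fin_bigcap_measurable => [|p _]; first exact: finite_finset.
  by apply: measurable_funPTI.
by apply/seteqP; split=> [w h [k t] _|w h k t]; [exact: h|exact: (h (k, t))].
Qed.

(** By [realization_indep], the probability of [typical] is a product of Dirac masses, all equal to
    1. *)
Lemma atypical_null : sample_prob G (~` typical) = 0%E.
Proof.
rewrite probability_setC; last exact: measurable_typical.
have := @realization_indep _ _ _ _ _ G setT (fun k _ => [set (k == j)%:R])
  measurableT (fun k t => measurable_set1 _).
rewrite preimage_setT setTI => ->; rewrite probability_setT mul1e.
rewrite big1 ?subee// => k _; rewrite big1// => t _.
have := @reward_distribution _ _ _ _ _ G k t [set (k == j)%:R] (measurable_set1 _).
by rewrite /distribution /pushforward => ->; rewrite /= /spike_law/= diracE mem_set.
Qed.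

Lemma histories_null m t w : typical w -> (t <= T)%N ->
  (count_mem j (null_arms t (seed G w)) <= m)%N ->
  map fst (histories (suppression m) t w).1 = null_arms t (seed G w) /\
  (histories (suppression m) t w).2 = [seq (i, 0) | i <- null_arms t (seed G w)].
Proof.
move=> Ew; elim: t => [//|t IH] tT /=.
rewrite -cats1 count_cat/= addn0 => cm.
have [||rawE ->] := IH; [exact: ltnW|by apply: leq_trans cm; exact: leq_addr|].
rewrite !map_rcons rawE /= /suppress rawE cats1 map_rcons.
set i := decide _ _ in cm *; split=> //; congr (rcons _ (_, _)).
(* The count in [cm] includes the current pull: if [i] is [j], fewer than [m] pulls of [j] precede
   it and the reward 1 is zeroed; any other arm pays 0 anyway. *)
rewrite (Ew i (Ordinal tT)); move: cm.
by case: (i == j) => //=; rewrite addn1 => ->.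
Qed.

(** Regret is measured on raw rewards, so each pull of an arm other than [j] costs 1 whatever the
    attack; [histories_null] reads these pulls off the null world. *)
Lemma regret_ge_missed n m w : typical w -> (n <= T)%N ->
  missed n m j (seed G w) <= regret_against (suppression m) j w.
Proof.
move=> Ew nT.
have termE (t : 'I_T) : reward G j t w -
    reward G (pulled_arm (suppression m) t w) t w =
    (pulled_arm (suppression m) t w != j)%:R.
  by rewrite !Ew eqxx; case: (_ == j); rewrite ?subrr ?subr0.
rewrite /regret_against (eq_bigr _ (fun t _ => termE t)) /missed.
case: ifPn => cm; last by apply: sumr_ge0 => t _; rewrite ler0n.
rewrite -natr_sum ler_nat -(big_mkord xpredT
  (fun t => (pulled_arm (suppression m) t w != j : nat))).
(* The rounds from [n] on contribute nonnegative terms and are dropped. *)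
rewrite (big_cat_nat (leq0n n) nT)/=; apply: leq_trans (leq_addr _ _).
elim: n nT cm => [//|n IH] nT /=.
rewrite -cats1 !count_cat/= addn0 => cm.
have cm' : (count_mem j (null_arms n (seed G w)) <= m)%N.
  by apply: leq_trans cm; exact: leq_addr.
rewrite big_nat_recr//=; have := IH (ltnW nT) cm'.
rewrite [pulled_arm _ n w]/pulled_arm; have [_ ->] := histories_null Ew (ltnW nT) cm'.
by case: (_ == j); lia.
Qed.

Lemma integral_missed_seed n m :
  (\int[seed_law alg]_s (missed n m j s)%:E =
   \int[sample_prob G]_w (missed n m j (seed G w))%:E)%E.
Proof.
rewrite -[RHS](@ge0_integral_distribution _ _ _ _ _ _ (seed G)
  (fun s => (missed n m j s)%:E)).
- by apply: eq_measure_integral => A mA _; exact/esym/seed_distribution.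
- by apply/measurable_EFinP; exact: measurable_missed.
- by move=> s; rewrite lee_fin missed_ge0.
Qed.

Lemma integral_ge_missed n m (f : sample_space G -> \bar R) :
  (forall w, typical w -> (missed n m j (seed G w))%:E <= f w)%E ->
  (\int[seed_law alg]_s (missed n m j s)%:E <=
   \int[sample_prob G]_w f w)%E.
Proof.
move=> mf; rewrite integral_missed_seed.
apply: (@integral_ge_of_ge_on_conull _ _ _ _ typical).
- exact: measurable_typical.
- exact: atypical_null.
- apply/measurable_EFinP; apply: measurableT_comp => //; exact: measurable_missed.
- by move=> w; rewrite lee_fin missed_ge0.
- exact: mf.
Qed.

Lemma expected_regret_ge_missed n m : (n <= T)%N ->
  (\int[seed_law alg]_s (missed n m j s)%:E <=
   expected_regret (suppression m) G)%E.
Proof.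
move=> nT; apply: integral_ge_missed => w Ew.
by apply: (bigmax_sup j) => //; rewrite lee_fin regret_ge_missed.
Qed.

Lemma pseudo_regret_ge_missed n m : (n <= T)%N ->
  (\int[seed_law alg]_s (missed n m j s)%:E <=
   pseudo_regret (suppression m) G)%E.
Proof.
move=> nT; apply: (bigmax_sup j) => //; rewrite unlock.
by apply: integral_ge_missed => w Ew; rewrite lee_fin regret_ge_missed.
Qed.

End suppression.

(** * Choice of the horizon and conclusion *)

Lemma exists_horizon (R : realType) (K T : nat) (C : R) :
  (1 < K)%N -> 0 <= C -> K%:R * C < T%:R ->
  exists n m : nat, [/\ (m < n)%N, (n.*2 <= K * m.+1)%N, (n <= T)%N,
    m%:R <= C & 6^-1 * (K%:R * C) <= n%:R / 2].
Proof.
move=> K1 C0 KT; set m := Num.truncn C.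
have /andP[mC Cm] := truncn_itv C0.
have KT' : (K * m < T)%N.
  by rewrite -(ltr_nat R) natrM (le_lt_trans _ KT)// ler_wpM2l.
exists (minn T (K * m.+1)./2), m; split => //; [nia|lia|lia|].
have KC : K%:R * C <= (K * m.+1)%:R by rewrite natrM ler_wpM2l// ltW.
(* The 3 absorbs the rounding: half of a natural number [x >= 2], rounded down, is at least [x / 3],
   with equality at 3. The halving in [n / 2] turns it into 6. *)
suff : K%:R * C <= (3 * minn T (K * m.+1)./2)%:R.
  rewrite natrM; lra.
case: (leqP T (K * m.+1)./2) => h.
  by rewrite natrM; have := ler0n R T; lra.
apply: (le_trans KC); rewrite ler_nat; nia.
Qed.

Theorem theorem1 (R : realType) :
  exists c : R, 0 < c /\
  forall (K T : nat) (C : R),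
    (1 < K)%N -> 0 <= C -> K%:R * C < T%:R ->
  forall alg : bandit_algorithm R K,
  exists (inst : bandit_instance R K) (adv : attack_policy R K),
    has_budget T C adv /\
    forall G : realization T alg inst,
      ((c * (K%:R * C))%:E <= pseudo_regret adv G)%E /\
      ((c * (K%:R * C))%:E <= expected_regret adv G)%E.
Proof.
exists 6^-1; split=> [|K T C K1 C0 KT alg]; first by rewrite invr_gt0.
have [n [m [mn nK nT mC bound]]] := exists_horizon K1 C0 KT.
(* The arm is chosen from [alg] and the parameters only, hence one instance and one attack serve all
   realizations. *)
have [j missj] := exists_missed alg (ltnW K1) mn nK.
exists (spike R j), (suppression R j m); split=> [a x x01|G].
  by apply: le_trans mC; exact: suppression_budget.
have low : ((6^-1 * (K%:R * C))%:E <= \int[seed_law alg]_s (missed n m j s)%:E)%E.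
  by apply: le_trans missj; rewrite lee_fin.
by split; apply: (le_trans low);
  [exact: pseudo_regret_ge_missed|exact: expected_regret_ge_missed].
Qed.
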